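(* Let $h_0,h_1\ge 0$ be real with $h_0^2+h_1^2=1$ and let $\varphi\in\mathbb R$. Alice's Hilbert space is $\mathbb C^2$ with orthonormal basis $|H\rangle,|V\rangle$. Bob's Hilbert space is $\mathbb C^2_{\rm pol}\otimes\mathbb C^2_{\rm path}$, where $\mathbb C^2_{\rm pol}$ has orthonormal basis $|H\rangle,|V\rangle$ and $\mathbb C^2_{\rm path}$ has orthonormal basis $|{+1}\rangle,|{-1}\rangle$. Consider the state $$|\psi\rangle=h_0\,|H,+1\rangle_B|H\rangle_A+h_1e^{i\varphi}\,|V,-1\rangle_B|V\rangle_A .$$ On a qubit with orthonormal basis $|e_0\rangle,|e_1\rangle$, let $X$ and $Y$ be the two-outcome (outcomes $0,1$) projective measurements with eigenvectors $$|X{=}1\rangle=h_1|e_0\rangle+h_0e^{i\varphi/3}|e_1\rangle,\qquad |X{=}0\rangle=h_0|e_0\rangle-h_1e^{i\varphi/3}|e_1\rangle,$$ $$|Y{=}1\rangle=\tfrac{1}{\sqrt2}\left(|e_0\rangle+ie^{i\varphi/3}|e_1\rangle\right),\qquad |Y{=}0\rangle=\tfrac{1}{\sqrt2}\left(|e_0\rangle-ie^{i\varphi/3}|e_1\rangle\right).$$ Let $X_1,Y_1$ be these measurements on Bob's polarization ($e_0=H,e_1=V$), $X_1',Y_1'$ these measurements on Bob's path ($e_0=+1,e_1=-1$), and $X_2,Y_2$ these measurements on Alice's system ($e_0=H,e_1=V$). Alice's local contexts are $\{X_2\}$ and $\{Y_2\}$; Bob's local contexts are $\{X_1,X_1'\},\{X_1,Y_1'\},\{Y_1,X_1'\},\{Y_1,Y_1'\}$;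 the tested family $\mathcal C$ consists of all eight pairs of an Alice context and a Bob context. Then, for the quantum probabilities generated by $|\psi\rangle$: (i) both Alice and Bob are locally noncontextual (NCHV-local holds); (ii) for every $0\le h_0\le 1$ the empirical model on $\mathcal C$ admits a GLHV decomposition with respect to the Alice–Bob partition; (iii) for every $0<h_0<1$ the empirical model on $\mathcal C$ admits no GNCHV model. Hence for every $0<h_0<1$ the experiment is globally contextual.
   Context: Definitions (for parties $i=1,\dots,n$; here $n=2$). Party $i$ has a set $\mathcal M_i$ of measurements and a family $\mathcal C_i$ of local contexts; a local context $C_i\in\mathcal C_i$ is a set of compatible (jointly measurable, here commuting) measurements of party $i$, and $m_{ij}$ denotes the outcome of $j\in C_i$. A multipartite context is $C=(C_1,\dots,C_n)$, and the tested family is $\mathcal C\subseteq\mathcal C_1\times\cdots\times\mathcal C_n$. The empirical model assigns to each $C\in\mathcal C$ the joint outcome distribution $p_C$ (given by the Born rule for the joint measurement of all commuting projectors involved), and $p_{C_i}$ is the corresponding distribution for party $i$ alone (from the reduced state). NCHV-local: party $i$ is locally noncontextual if there are a hidden variable $\lambda_i$ with a single probability distribution $q_i$ and response probability distributions $p_i(\cdot|j,\lambda_i)$, one for each measurement $j$ and not depending on the context, such that $p_{C_i}(\{m_{ij}\}_{j\in C_i})=\sum_{\lambda_i}q_i(\lambda_i)\prod_{j\in C_i}p_i(m_{ij}|j,\lambda_i)$ for every $C_i\in\mathcal C_i$. NCHV-local holds if every party satisfies this. GLHV: there are one hidden variable $\lambda$, one probability distribution $q(\lambda)$ common to all tested contexts,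 and block response distributions $p_i(\cdot|C_i,\lambda)$ (arbitrary joint distributions of the outcomes of the measurements in $C_i$) such that $p_C(\{\{m_{ij}\}_{j\in C_i}\}_{i})=\sum_\lambda q(\lambda)\prod_{i=1}^n p_i(\{m_{ij}\}_{j\in C_i}|C_i,\lambda)$ for every $C\in\mathcal C$. GNCHV: there are one hidden variable $\xi$, one probability distribution $q(\xi)$, and context-independent response distributions $p(\cdot|j,\xi)$, one for each measurement $j\in\bigcup_i\mathcal M_i$, such that $p_C(\{\{m_{ij}\}_{j\in C_i}\}_i)=\sum_\xi q(\xi)\prod_{i=1}^n\prod_{j\in C_i}p(m_{ij}|j,\xi)$ for every $C\in\mathcal C$. The experiment is globally contextual if NCHV-local and GLHV hold but no GNCHV model exists. *)

(* Defs.v *)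
From HB Require Import structures.
From mathcomp Require Import all_boot all_order all_algebra.
From mathcomp Require Import all_classical all_reals all_analysis.
From mathcomp Require Import complex mxtens spectral.

Set Implicit Arguments.
Unset Strict Implicit.
Unset Printing Implicit Defensive.

Import Order.TTheory GRing.Theory Num.Theory.
Local Open Scope ring_scope.
Local Open Scope complex_scope.
Local Open Scope sesquilinear_scope.

(* Hidden variables are discrete, but range over an arbitrary (possibly
   infinite) type, hence the unordered sum [esum]. *)
Definition is_pmf (R : realType) (T : choiceType) (q : T -> R) : Prop :=
  (forall x, 0 <= q x) /\ \esum_(x in [set: T]%classic) (q x)%:E = 1%E.

Section HiddenVariables.
Variables (R : realType) (I : finType) (M : I -> finType) (O : finType).

Definition outcome (i : I) (c : {set M i}) := {ffun {j : M i | j \in c} -> O}.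

Definition context := forall i : I, {set M i}.

Definition joint_outcome (C : context) := forall i : I, outcome (C i).

Definition local_model := forall (i : I) (c : {set M i}), outcome c -> R.

Definition empirical_model := forall C : context, joint_outcome C -> R.

Definition NCHV_local (Cl : forall i, {set {set M i}}) (pl : local_model) :
    Prop :=
  forall i : I,
  exists (L : choiceType) (q : L -> R) (resp : M i -> L -> O -> R),
  [/\ is_pmf q, forall j l, is_pmf (resp j l) &
      forall c : {set M i}, c \in Cl i -> forall m : outcome c,
      (pl i c m)%:E = \esum_(l in [set: L]%classic)
                    (q l * \prod_(j : {j | j \in c}) resp (val j) l (m j))%:E].

Definition GLHV (tested : context -> Prop) (p : empirical_model) : Prop :=
  exists (L : choiceType) (q : L -> R)
         (resp : forall (i : I) (c : {set M i}), L -> outcome c -> R),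
  [/\ is_pmf q, forall i c l, is_pmf (@resp i c l) &
      forall C : context, tested C -> forall m : joint_outcome C,
      (p C m)%:E = \esum_(l in [set: L]%classic)
                     (q l * \prod_(i : I) resp i (C i) l (m i))%:E].

Definition GNCHV (tested : context -> Prop) (p : empirical_model) : Prop :=
  exists (L : choiceType) (q : L -> R)
         (resp : forall i : I, M i -> L -> O -> R),
  [/\ is_pmf q, forall i j l, is_pmf (@resp i j l) &
      forall C : context, tested C -> forall m : joint_outcome C,
      (p C m)%:E = \esum_(l in [set: L]%classic)
        (q l * \prod_(i : I) \prod_(j : {j | j \in C i})
                 resp i (val j) l (m i j))%:E].

Definition globally_contextual (Cl : forall i, {set {set M i}})
    (tested : context -> Prop) (pl : local_model) (p : empirical_model) : Prop :=
  [/\ NCHV_local Cl pl, GLHV tested p & ~ GNCHV tested p].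

End HiddenVariables.

Inductive party := Bob | Alice.

Definition bool_of_party i := if i is Alice then true else false.
Definition party_of_bool (b : bool) := if b then Alice else Bob.
Lemma bool_of_partyK : cancel bool_of_party party_of_bool. Proof. by case. Qed.
HB.instance Definition _ := Finite.copy party (can_type bool_of_partyK).

Section BornRule.
Variables (R : realType) (d : party -> nat) (M : party -> finType) (O : finType).
(* [P i j o] is the projector of outcome [o] of measurement [j] of party [i]. *)
Variable P : forall i : party, M i -> O -> 'M[R[i]]_(d i).
Variable psi : 'cV[R[i]]_(d Bob * d Alice).

Definition density : 'M[R[i]]_(d Bob * d Alice) := psi *m psi ^t*.

(* The partial trace of [density] over the other party. *)
Definition reduced (i : party) : 'M[R[i]]_(d i) :=
  match i with
  | Bob => \matrix_(k, k') \sum_(l < d Alice)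
             density (mxtens_index (k, l)) (mxtens_index (k', l))
  | Alice => \matrix_(l, l') \sum_(k < d Bob)
             density (mxtens_index (k, l)) (mxtens_index (k, l'))
  end.

(* The projectors of a local context commute, so that the order in which this
   product is taken is irrelevant. *)
Definition joint_proj (i : party) (c : {set M i}) (m : outcome O c) :
    'M[R[i]]_(d i) :=
  \big[mulmx/1%:M]_(j : {j | j \in c}) P (val j) (m j).

(* The traces below are real; [complex.Re] only casts them to [R]. *)
Definition born_local : local_model R M O :=
  fun i c m => complex.Re (\tr (reduced i *m joint_proj m)).

Definition born : empirical_model R M O :=
  fun C m => complex.Re
    (\tr (density *m (joint_proj (m Bob) *t joint_proj (m Alice)))).

End BornRule.

Inductive setting := X | Y.

Definition bool_of_setting s := if s is Y then true else false.
Definition setting_of_bool (b : bool) := if b then Y else X.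
Lemma bool_of_settingK : cancel bool_of_setting setting_of_bool.
Proof. by case. Qed.
HB.instance Definition _ := Finite.copy setting (can_type bool_of_settingK).

(* For Bob, [inl] is the measurement of the polarization (X_1, Y_1) and [inr]
   that of the path (X_1', Y_1'); for Alice, [X] and [Y] stand for X_2, Y_2. *)
Definition meas (i : party) : finType :=
  match i with Bob => (setting + setting)%type | Alice => setting end.

Definition hdim (i : party) : nat := match i with Bob => (2 * 2)%N | Alice => 2 end.

Definition local_contexts (i : party) : {set {set meas i}} :=
  match i with
  | Bob => [set [set inl X; inr X]; [set inl X; inr Y];
                [set inl Y; inr X]; [set inl Y; inr Y]]
  | Alice => [set [set X]; [set Y]]
  end.

Definition tested_contexts (C : context meas) : Prop :=
  forall i, C i \in local_contexts i.

Section Experiment.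
Variables (R : realType) (h0 h1 phi : R).

Definition expi (t : R) : R[i] := cos t +i* sin t.

Definition tens_vec (m n : nat) (u : 'cV[R[i]]_m) (v : 'cV[R[i]]_n) :
  'cV[R[i]]_(m * n) := u *t v.

(* [d] orthonormal vectors of C^d form a basis. *)
Definition orthonormal_basis (d : nat) (e : 'I_d -> 'cV[R[i]]_d) : Prop :=
  forall k l, (e k) ^t* *m e l = ((k == l)%:R)%:M.

(* Outcomes 0 and 1 are [false] and [true]. *)
Definition eigenvector (e : 'I_2 -> 'cV[R[i]]_2) (s : setting) (o : bool) :
    'cV[R[i]]_2 :=
  match s, o with
  | X, true => h1%:C *: e 0 + (h0%:C * expi (phi / 3)) *: e 1
  | X, false => h0%:C *: e 0 - (h1%:C * expi (phi / 3)) *: e 1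
  | Y, true => ((Num.sqrt 2)^-1)%:C *: (e 0 + ('i * expi (phi / 3)) *: e 1)
  | Y, false => ((Num.sqrt 2)^-1)%:C *: (e 0 - ('i * expi (phi / 3)) *: e 1)
  end.

Definition qubit_proj (e : 'I_2 -> 'cV[R[i]]_2) (s : setting) (o : bool) :
    'M[R[i]]_2 :=
  eigenvector e s o *m (eigenvector e s o) ^t*.

(* The bases (|H>, |V>) and (|+1>, |-1>) of Bob, and (|H>, |V>) of Alice. *)
Variables polB pathB polA : 'I_2 -> 'cV[R[i]]_2.

Definition psi : 'cV[R[i]]_(hdim Bob * hdim Alice) :=
  h0%:C *: tens_vec (tens_vec (polB 0) (pathB 0)) (polA 0) +
  (h1%:C * expi phi) *: tens_vec (tens_vec (polB 1) (pathB 1)) (polA 1).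

Definition meas_proj (i : party) : meas i -> bool -> 'M[R[i]]_(hdim i) :=
  match i with
  | Bob => fun j o => match j with
                      | inl s => qubit_proj polB s o *t 1%:M
                      | inr s => 1%:M *t qubit_proj pathB s o
                      end
  | Alice => qubit_proj polA
  end.

Definition p_local : local_model R meas bool := born_local meas_proj psi.

Definition p_joint : empirical_model R meas bool := born meas_proj psi.

End Experiment.

(* Main.v *)
(** The phases [expi (phi / 3)] of the eigenvectors absorb the phase of the
    state, so that all three systems behave as qubits in the state
    [h0 |000> + h1 |111>].

    - Local noncontextuality: the reduced states are mixtures of product basis
      states, and the index of the basis vector is the hidden variable.
    - GLHV: Alice has two binary measurements only, so a local model is a joint
      distribution of her outcomes [(x, y)] for [X_2] and [Y_2] that extends,
      for each Bob context, to Bob's outcomes with the right marginals.  Make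
      [x] and [y] independent conditionally on Bob's outcomes: complex
      conjugation of the amplitudes flips the outcomes of all [Y] measurements,
      so that the resulting distribution of [(x, y)] is [P(x) / 2] for every
      Bob context.
    - No GNCHV: [X_i = 1] projects the other two qubits onto a maximally
      entangled state in which the outcomes of [Y] always differ, and three bits
      cannot be pairwise distinct, although [X_1 = X_1' = X_2 = 1] has
      probability [(h0 * h1) ^+ 2 > 0]. *)
Require Import Defs.
From HB Require Import structures.
From mathcomp Require Import all_boot all_order all_algebra.
From mathcomp Require Import all_classical all_reals all_analysis.
From mathcomp Require Import complex mxtens spectral ring.

Set Implicit Arguments.
Unset Strict Implicit.
Unset Printing Implicit Defensive.

Import Order.TTheory GRing.Theory Num.Theory.
Local Open Scope ring_scope.

(** * Discrete sums and probability mass functions *)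

Lemma esum_finType (R : realType) (T : finType) (f : T -> R) :
  (forall x, 0 <= f x) ->
  \esum_(x in [set: T]%classic) (f x)%:E = (\sum_x f x)%:E.
Proof.
move=> f_ge0; rewrite esum_fset; last 2 first.
- exact: finite_finset.
- by move=> x _; rewrite lee_fin.
rewrite -sumEFin [RHS](bigfs _ (index_enum_uniq T)) ?set_true// => x _.
by rewrite mem_index_enum.
Qed.

Lemma is_pmf_finType (R : realType) (T : finType) (q : T -> R) :
  (forall x, 0 <= q x) -> \sum_x q x = 1 -> is_pmf q.
Proof. by move=> q_ge0 q1; split=> //; rewrite esum_finType ?q1. Qed.

(** The sum dominates each of its nonnegative terms. Applied to a hidden-variable model on an
    arbitrary type, this turns a vanishing probability into a vanishing contribution of every single
    hidden value. *)
Lemma esum_eq0P (R : realType) (T : choiceType) (f : T -> R) :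
  (forall x, 0 <= f x) ->
  \esum_(x in [set: T]%classic) (f x)%:E = 0%E <-> forall x, f x = 0.
Proof.
move=> f_ge0; split=> [f0 x|f0]; last by rewrite esum1// => x _; rewrite f0.
apply/le_anti; rewrite f_ge0 andbT.
suff: ((f x)%:E <= 0)%E by rewrite lee_fin.
rewrite -f0 esum_ge//; exists [set x]%classic; last by rewrite fsbig_set1.
by split=> //; exact: finite_set1.
Qed.

Lemma pmf_supp (R : realType) (T : choiceType) (q : T -> R) :
  is_pmf q -> exists x, q x != 0.
Proof.
move=> [q_ge0 q1]; apply/not_existsP => q0; move: q1.
rewrite (esum_eq0P q_ge0).2 => [/eqP|x].
  by rewrite eqe eq_sym oner_eq0.
by apply/eqP/negP=> /negP/q0.
Qed.

Section Normalize.
Variables (R : realType) (T : finType) (x0 : T) (f : T -> R).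

(** A response must be a distribution at every hidden value, so a zero total falls back on the point
    mass at [x0]. *)
Definition normalize (x : T) : R :=
  if \sum_y f y == 0 then (x == x0)%:R else f x / \sum_y f y.

Hypothesis f_ge0 : forall x, 0 <= f x.

Lemma normalize_pmf : is_pmf normalize.
Proof.
apply: is_pmf_finType => [x|]; rewrite /normalize.
  by case: ifP => // _; rewrite divr_ge0 ?sumr_ge0.
case: eqVneq => [_|Sf]; last by rewrite -mulr_suml divff.
by rewrite (bigD1 x0) //= eqxx big1 ?addr0// => x /negPf->.
Qed.

(** If the total is zero, nonnegativity makes [f] vanish identically, so the fallback value is
    multiplied by zero and does no harm. *)
Lemma sum_mul_normalize x : (\sum_y f y) * normalize x = f x.
Proof.
rewrite /normalize; case: eqVneq => [Sf|Sf]; last by rewrite mulrC divfK.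
rewrite Sf mul0r; apply/esym/eqP; move/eqP: Sf.
by rewrite psumr_eq0// => /allP; apply; rewrite mem_index_enum.
Qed.

End Normalize.

(** * Outcomes of local contexts as tuples of bits *)

Section Outcomes.
Variables (M : party -> finType) (O : finType) (i : party).
Implicit Types c : {set M i}.

(** Total reading of an outcome, free of membership proofs; [o0] shows up only outside [c]. *)
Definition outcome_at (o0 : O) c (m : outcome O c) (j : M i) : O :=
  oapp m o0 (insub j).

Lemma outcome_at_val o0 c (m : outcome O c) (j : {j | j \in c}) :
  outcome_at o0 m (val j) = m j.
Proof. by rewrite /outcome_at valK. Qed.

Lemma prod_outcome (R : realType) o0 c (m : outcome O c) (F : M i -> O -> R) :
  \prod_(j : {j | j \in c}) F (val j) (m j) =
  \prod_(j in c) F j (outcome_at o0 m j).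
Proof.
rewrite [RHS]big_sub; apply: eq_bigr => j _; congr (F (val j) _).
by rewrite outcome_at_val.
Qed.

Lemma outcome_at_finfun o0 c (f : M i -> O) j :
  j \in c -> outcome_at o0 ([ffun j' => f (val j')] : outcome O c) j = f j.
Proof. by move=> jc; rewrite /outcome_at insubT /= ffunE. Qed.

End Outcomes.

Definition bob_context (s s' : setting) : {set meas Bob} :=
  [set inl s; inr s'].

Lemma in_bob_context s s' j :
  j \in bob_context s s' -> j = inl s \/ j = inr s'.
Proof. by move/set2P. Qed.

Lemma local_contexts_bob c :
  c \in local_contexts Bob -> exists s s', c = bob_context s s'.
Proof.
rewrite !inE => /orP[/orP[/orP[]|]|] /eqP->; do 2!eexists; reflexivity.
Qed.

Lemma local_contexts_alice (c : {set meas Alice}) :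
  c \in local_contexts Alice -> exists s, c = [set s].
Proof. by rewrite !inE => /orP[] /eqP->; eexists. Qed.

Lemma bob_context_local s s' : bob_context s s' \in local_contexts Bob.
Proof. by case: s; case: s'; rewrite !inE eqxx ?orbT. Qed.

Lemma alice_context_local (s : setting) :
  ([set s] : {set meas Alice}) \in local_contexts Alice.
Proof. by case: s; rewrite !inE eqxx ?orbT. Qed.

Local Notation at_ := (outcome_at false).

(** Outcomes of a Bob context biject with pairs of bits. The context enters through an equation,
    which avoids transporting dependent outcomes. *)
Lemma sum_outcome_bob (R : realType) s s' c (G : bool -> bool -> R) :
  c = bob_context s s' ->
  \sum_(m : outcome bool c) G (at_ m (inl s)) (at_ m (inr s')) =
  \sum_a \sum_b G a b.
Proof.
move=> ec.
have cl : inl s \in c by rewrite ec !inE eqxx.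
have cr : inr s' \in c by rewrite ec !inE eqxx orbT.
rewrite pair_big /=.
pose h (ab : bool * bool) : outcome bool c :=
  [ffun j => if val j is inl _ then ab.1 else ab.2].
have hl ab : at_ (h ab) (inl s) = ab.1.
  exact: (outcome_at_finfun (i := Bob) _
    (fun j : meas Bob => if j is inl _ then ab.1 else ab.2)).
have hr ab : at_ (h ab) (inr s') = ab.2.
  exact: (outcome_at_finfun (i := Bob) _
    (fun j : meas Bob => if j is inl _ then ab.1 else ab.2)).
rewrite (reindex h) /=; first by apply: eq_bigr => ab _; rewrite hl hr.
exists (fun m => (at_ m (inl s), at_ m (inr s'))) => [[a b] _|m _].
  by rewrite hl hr.
apply/ffunP=> j; rewrite ffunE; case: j => [j jc] /=.
have [ej|ej] : j = inl s \/ j = inr s' by apply: in_bob_context; rewrite -ec.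
  by subst j; rewrite -(outcome_at_val false).
by subst j; rewrite -(outcome_at_val false).
Qed.

Lemma prod_outcome_bob (R : realType) s s' c (m : outcome bool c)
    (F : meas Bob -> bool -> R) : c = bob_context s s' ->
  \prod_(j : {j | j \in c}) F (val j) (m j) =
  F (inl s) (at_ m (inl s)) * F (inr s') (at_ m (inr s')).
Proof.
by move=> ec; subst c; rewrite (prod_outcome false) big_setU1 ?inE//= big_set1.
Qed.

Lemma prod_outcome_alice (R : realType) (s : meas Alice) c (m : outcome bool c)
    (F : meas Alice -> bool -> R) : c = [set s] ->
  \prod_(j : {j | j \in c}) F (val j) (m j) = F s (at_ m s).
Proof. by move=> ec; subst c; rewrite (prod_outcome false) big_set1. Qed.

Lemma sum_bool (V : nmodType) (F : bool -> V) : \sum_b F b = F true + F false.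
Proof. by rewrite big_bool. Qed.

Lemma prod_party (R : realType) (F : party -> R) :
  \prod_i F i = F Bob * F Alice.
Proof.
rewrite (bigD1 Bob)//=; congr (_ * _); apply: big_pred1.
by case.
Qed.

(** * Outcome probabilities as real polynomials *)

Section Probabilities.
Variables (R : realType) (h0 h1 : R).
Hypothesis h01 : h0 ^+ 2 + h1 ^+ 2 = 1.

Let r : R := (Num.sqrt 2)^-1.

Let r2 : r ^+ 2 = 2^-1.
Proof. by rewrite /r exprVn sqr_sqrtr. Qed.

(* Up to the phase [expi (phi / 3)] of the second one, the components of
   [eigenvector e s o] are [coef0 s o] and [recoef1 s o +i* imcoef1 s o]. *)
Definition coef0 (s : setting) (o : bool) : R :=
  match s, o with X, true => h1 | X, false => h0 | Y, _ => r end.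

Definition recoef1 (s : setting) (o : bool) : R :=
  match s, o with X, true => h0 | X, false => - h1 | Y, _ => 0 end.

Definition imcoef1 (s : setting) (o : bool) : R :=
  match s, o with X, _ => 0 | Y, true => r | Y, false => - r end.

Definition weight0 s o := coef0 s o ^+ 2.

Definition weight1 s o := recoef1 s o ^+ 2 + imcoef1 s o ^+ 2.

(* The squared modulus of the amplitude [h0 * coef0 + h1 * coef1], where
   [coef1 = recoef1 +i* imcoef1], with products over the three systems. *)
Definition prob3 s a s' b t c : R :=
  let a1 := recoef1 s a in let a2 := imcoef1 s a in
  let b1 := recoef1 s' b in let b2 := imcoef1 s' b in
  let c1 := recoef1 t c in let c2 := imcoef1 t c in
  (h0 * (coef0 s a * coef0 s' b * coef0 t c) +
   h1 * ((a1 * b1 - a2 * b2) * c1 - (a1 * b2 + a2 * b1) * c2)) ^+ 2 +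
  (h1 * ((a1 * b1 - a2 * b2) * c2 + (a1 * b2 + a2 * b1) * c1)) ^+ 2.

Definition prob2 s a s' b : R :=
  h0 ^+ 2 * (weight0 s a * weight0 s' b) +
  h1 ^+ 2 * (weight1 s a * weight1 s' b).

Definition prob1 s a : R := h0 ^+ 2 * weight0 s a + h1 ^+ 2 * weight1 s a.

Lemma weight0_ge0 s o : 0 <= weight0 s o.
Proof. exact: sqr_ge0. Qed.

Lemma weight1_ge0 s o : 0 <= weight1 s o.
Proof. by rewrite addr_ge0 ?sqr_ge0. Qed.

Lemma prob3_ge0 s a s' b t c : 0 <= prob3 s a s' b t c.
Proof. by rewrite addr_ge0 ?sqr_ge0. Qed.

Lemma prob2_ge0 s a s' b : 0 <= prob2 s a s' b.
Proof.
by apply: addr_ge0; rewrite mulr_ge0 ?sqr_ge0//;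
  rewrite mulr_ge0 ?weight0_ge0 ?weight1_ge0.
Qed.

Lemma prob1_ge0 s a : 0 <= prob1 s a.
Proof.
by apply: addr_ge0; rewrite mulr_ge0 ?sqr_ge0 ?weight0_ge0 ?weight1_ge0.
Qed.

Lemma sum_weight0 s : \sum_o weight0 s o = 1.
Proof.
rewrite sum_bool /weight0; case: s => /=; first by rewrite addrC h01.
by rewrite r2; field.
Qed.

Lemma sum_weight1 s : \sum_o weight1 s o = 1.
Proof.
rewrite sum_bool /weight1; case: s => /=.
  by rewrite sqrrN !expr0n !addr0 h01.
by rewrite sqrrN expr0n !add0r r2; field.
Qed.

(** Off-diagonal part of the completeness relation of the eigenvectors; the sums of [weight0] and
    [weight1] are its diagonal part. *)
Lemma sum_coef01 s :
  \sum_o coef0 s o * recoef1 s o = 0 /\ \sum_o coef0 s o * imcoef1 s o = 0.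
Proof. by rewrite !sum_bool; case: s => /=; split; ring. Qed.

(* The interference term of [prob3] is linear in [coef0 t * coef1 t], whose sum
   over the outcomes of [t] vanishes. *)
Lemma sum_prob3_alice s a s' b t : \sum_c prob3 s a s' b t c = prob2 s a s' b.
Proof.
have [re0 im0] := sum_coef01 t.
pose p := recoef1 s a * recoef1 s' b - imcoef1 s a * imcoef1 s' b.
pose q := recoef1 s a * imcoef1 s' b + imcoef1 s a * recoef1 s' b.
pose u := coef0 s a * coef0 s' b.
transitivity (h0 ^+ 2 * u ^+ 2 * \sum_c weight0 t c +
    h1 ^+ 2 * (p ^+ 2 + q ^+ 2) * \sum_c weight1 t c +
    2 * h0 * h1 * u *
      (p * \sum_c coef0 t c * recoef1 t c -
       q * \sum_c coef0 t c * imcoef1 t c)).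
  by rewrite !sum_bool /prob3 /weight0 /weight1 /p /q /u; ring.
rewrite sum_weight0 sum_weight1 re0 im0 /prob2 /weight0 /weight1 /p /q /u.
ring.
Qed.

Lemma prob3_swap s a s' b t c : prob3 s a s' b t c = prob3 s a t c s' b.
Proof. by rewrite /prob3; ring. Qed.

Lemma sum_prob2_pol s s' b : \sum_a prob2 s a s' b = prob1 s' b.
Proof.
by rewrite /prob2 big_split -!mulr_sumr -!mulr_suml sum_weight0 sum_weight1
  !mul1r.
Qed.

Lemma sum_prob1 s : \sum_a prob1 s a = 1.
Proof.
by rewrite /prob1 big_split -!mulr_sumr sum_weight0 sum_weight1 !mulr1.
Qed.

Lemma sum_prob3_bob s s' t c :
  \sum_a \sum_b prob3 s a s' b t c = prob1 t c.
Proof.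
rewrite -(sum_prob2_pol s); apply: eq_bigr => a _.
by under eq_bigr do rewrite prob3_swap; rewrite sum_prob3_alice.
Qed.

(* Complex conjugation of the amplitudes exchanges the outcomes of [Y] and fixes
   those of [X]. *)
Definition conj_outcome (s : setting) (o : bool) : bool :=
  if s is Y then ~~ o else o.

Lemma sum_conj_outcome s (F : bool -> R) :
  \sum_o F (conj_outcome s o) = \sum_o F o.
Proof. by rewrite !sum_bool; case: s => //=; rewrite addrC. Qed.

Lemma coef_conj s o :
  [/\ coef0 s (conj_outcome s o) = coef0 s o,
      recoef1 s (conj_outcome s o) = recoef1 s o &
      imcoef1 s (conj_outcome s o) = - imcoef1 s o].
Proof. by case: s o => -[]; split; rewrite //= ?oppr0 ?opprK. Qed.

(** Conjugating all three outcomes conjugates the amplitude and keeps its modulus; since conjugation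
    is an involution, acting on Bob's two systems amounts to acting on Alice's. *)
Lemma prob3_conj s a s' b t c :
  prob3 s (conj_outcome s a) s' (conj_outcome s' b) t c =
  prob3 s a s' b t (conj_outcome t c).
Proof.
rewrite /prob3; have [-> -> ->] := coef_conj s a.
have [-> -> ->] := coef_conj s' b; have [-> -> ->] := coef_conj t c; ring.
Qed.

Lemma prob2_conj s a s' b :
  prob2 s (conj_outcome s a) s' (conj_outcome s' b) = prob2 s a s' b.
Proof.
rewrite /prob2 /weight0 /weight1; have [-> -> ->] := coef_conj s a.
by have [-> -> ->] := coef_conj s' b; rewrite !sqrrN.
Qed.

(* The joint weight of Bob's outcomes [a], [b] and of both outcomes [x] of [X_2]
   and [y] of [Y_2] when these are independent conditionally on [a] and [b]
   ([0] when [a], [b] is impossible, by the convention [z / 0 = 0]). *)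
Definition coupling s s' x y a b : R :=
  prob3 s a s' b X x * prob3 s a s' b Y y / prob2 s a s' b.

Lemma coupling_ge0 s s' x y a b : 0 <= coupling s s' x y a b.
Proof. by rewrite mulr_ge0 ?mulr_ge0 ?invr_ge0 ?prob3_ge0 ?prob2_ge0. Qed.

(** A zero marginal forces zero joint probabilities, so dividing by zero in [coupling] still gives
    the right marginals. *)
Lemma prob3_eq0 s a s' b t c : prob2 s a s' b = 0 -> prob3 s a s' b t c = 0.
Proof.
rewrite -(sum_prob3_alice s a s' b t) => /eqP; rewrite psumr_eq0.
  by move=> /allP/(_ c); rewrite mem_index_enum => /(_ isT)/eqP.
by move=> *; exact: prob3_ge0.
Qed.

Lemma sum_coupling_Y s s' x a b :
  \sum_y coupling s s' x y a b = prob3 s a s' b X x.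
Proof.
rewrite -mulr_suml -mulr_sumr sum_prob3_alice.
have [p0|p0] := eqVneq (prob2 s a s' b) 0; last by rewrite mulfK.
by rewrite prob3_eq0// !mul0r.
Qed.

Lemma sum_coupling_X s s' y a b :
  \sum_x coupling s s' x y a b = prob3 s a s' b Y y.
Proof.
rewrite -mulr_suml -mulr_suml sum_prob3_alice mulrC.
have [p0|p0] := eqVneq (prob2 s a s' b) 0; last by rewrite mulKf.
by rewrite p0 invr0 mul0r prob3_eq0.
Qed.

(* Conjugating Bob's outcomes replaces [y] by [~~ y], so that the sum below does
   not depend on [y]; in particular it does not depend on Bob's context. *)
Lemma sum_coupling_bob s s' x y :
  \sum_a \sum_b coupling s s' x y a b = prob1 X x / 2.
Proof.
pose S y := \sum_a \sum_b coupling s s' x y a b.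
have SN : S (~~ y) = S y.
  rewrite /S -[RHS](sum_conj_outcome s); apply: eq_bigr => a _.
  rewrite -[RHS](sum_conj_outcome s'); apply: eq_bigr => b _.
  by rewrite /coupling !prob3_conj prob2_conj.
have : \sum_y S y = prob1 X x.
  rewrite -(sum_prob3_bob s s') /S exchange_big; apply: eq_bigr => a _.
  by rewrite exchange_big; apply: eq_bigr => b _; rewrite sum_coupling_Y.
by rewrite -/(S y) sum_bool => <-; case: y SN => /= ->; field.
Qed.

(** The amplitude is [h0 * h1] times [r ^+ 2] plus the square of [r] or [- r] times the imaginary
    unit, and these cancel. *)
Lemma prob3_XYY_eq0 o : prob3 X true Y o Y o = 0.
Proof.
have rr : r * r = 2^-1 by rewrite -expr2.
by case: o; rewrite /prob3 /= !(mul0r, mulr0, sub0r, subr0, addr0, add0r);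
  rewrite -!mulrA ?mulrNN !rr; field.
Qed.

Lemma prob3_YXY_eq0 o : prob3 Y o X true Y o = 0.
Proof. by rewrite -(prob3_XYY_eq0 o) /prob3; ring. Qed.

Lemma prob3_YYX_eq0 o : prob3 Y o Y o X true = 0.
Proof. by rewrite prob3_swap prob3_YXY_eq0. Qed.

Lemma prob3_XXX_neq0 :
  h0 != 0 -> h1 != 0 -> prob3 X true X true X true != 0.
Proof.
move=> h0N h1N; suff -> : prob3 X true X true X true = (h0 * h1) ^+ 2.
  by rewrite expf_neq0// mulf_neq0.
(* The amplitude is [h0 * h1 ^+ 3 + h1 * h0 ^+ 3]. *)
transitivity ((h0 * h1 * (h0 ^+ 2 + h1 ^+ 2)) ^+ 2); last by rewrite h01 mulr1.
by rewrite /prob3 /=; ring.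
Qed.

End Probabilities.

(** * Adjoints, traces and tensor products of complex matrices *)

HB.instance Definition _ (R : pzSemiRingType) (n : nat) :=
  Monoid.isLaw.Build 'M[R]_n 1%:M mulmx (@mulmxA R n n n n) (@mul1mx R n n)
    (@mulmx1 R n n).

Section ComplexMatrices.
Local Open Scope complex_scope.
Local Open Scope sesquilinear_scope.
Variable R : realType.
Local Notation C := R[i].

Lemma conjCE (x y : R) : Num.conj (x +i* y : C) = x -i* y.
Proof. by []. Qed.

Lemma adjointM m n p (A : 'M[C]_(m, n)) (B : 'M[C]_(n, p)) :
  (A *m B) ^t* = B ^t* *m A ^t*.
Proof. by rewrite trmx_mul map_mxM. Qed.

Lemma adjointD m n (A B : 'M[C]_(m, n)) : (A + B) ^t* = A ^t* + B ^t*.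
Proof. by rewrite linearD map_mxD. Qed.

Lemma adjointZ m n a (A : 'M[C]_(m, n)) : (a *: A) ^t* = Num.conj a *: A ^t*.
Proof. by rewrite linearZ map_mxZ. Qed.

Lemma adjoint_tens m n p q (A : 'M[C]_(m, n)) (B : 'M[C]_(p, q)) :
  (A *t B) ^t* = A ^t* *t B ^t*.
Proof. by rewrite trmx_tens map_mxT. Qed.

Lemma rank1_comb n (a b : C) (x y : 'cV[C]_n) :
  (a *: x + b *: y) *m (a *: x + b *: y) ^t* =
  (a * Num.conj a) *: (x *m x ^t*) + (a * Num.conj b) *: (x *m y ^t*) +
  ((b * Num.conj a) *: (y *m x ^t*) + (b * Num.conj b) *: (y *m y ^t*)).
Proof.
rewrite adjointD !adjointZ mulmxDl !mulmxDr.
by rewrite -!scalemxAl -!scalemxAr !scalerA.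
Qed.

Lemma inner_comb n (a b : C) (x y z : 'cV[C]_n) :
  (a *: x + b *: y) ^t* *m z =
  Num.conj a *: (x ^t* *m z) + Num.conj b *: (y ^t* *m z).
Proof. by rewrite adjointD !adjointZ mulmxDl -!scalemxAl. Qed.

(** Cyclicity of the trace turns the Born rule for rank-one projectors into a squared modulus. *)
Lemma trace_rank1 n (x y : 'cV[C]_n) :
  \tr ((x *m x ^t*) *m (y *m y ^t*)) =
  (y ^t* *m x) 0 0 * Num.conj ((y ^t* *m x) 0 0).
Proof.
rewrite mulmxA mxtrace_mulC -(mulmxA x) (mulmxA (y ^t*)) trace_mx11 mxE.
rewrite big_ord_recl big_ord0 addr0; congr (_ * _).
by rewrite -[x ^t* *m y]trmxCK adjointM trmxCK !mxE.
Qed.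

Lemma tens_mxDl m n p q (A B : 'M[C]_(m, n)) (D : 'M[C]_(p, q)) :
  (A + B) *t D = A *t D + B *t D.
Proof. by apply/matrixP=> i j; rewrite !mxE mulrDl. Qed.

Lemma tens_mxDr m n p q (D : 'M[C]_(m, n)) (A B : 'M[C]_(p, q)) :
  D *t (A + B) = D *t A + D *t B.
Proof. by apply/matrixP=> i j; rewrite !mxE mulrDr. Qed.

Lemma tens_1mx m n : (1%:M : 'M[C]_m) *t (1%:M : 'M[C]_n) = 1%:M.
Proof.
apply/matrixP=> i j; case: (mxtens_indexP i) => i1 i2.
case: (mxtens_indexP j) => j1 j2; rewrite tensmxE !mxE -natrM mulnb.
by rewrite (inj_eq (can_inj (@mxtens_indexK _ _))) xpair_eqE.
Qed.

(** Resolving the identity on the second factor by a complete measurement expresses a marginal as a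
    sum of joint probabilities. *)
Lemma trace_tens_sumr m n (I : finType) (D : 'M[C]_(m * n)) (A : 'M[C]_m)
    (B : I -> 'M[C]_n) :
  \sum_o B o = 1%:M ->
  \tr (D *m (A *t 1%:M)) = \sum_o \tr (D *m (A *t B o)).
Proof.
move=> <-; rewrite (big_morph _ (tens_mxDr A) (tensmx0 A)).
by rewrite mulmx_sumr linear_sum.
Qed.

Lemma trace_tens_suml m n (I : finType) (D : 'M[C]_(m * n)) (A : I -> 'M[C]_m)
    (B : 'M[C]_n) :
  \sum_o A o = 1%:M ->
  \tr (D *m (1%:M *t B)) = \sum_o \tr (D *m (A o *t B)).
Proof.
move=> <-; rewrite (big_morph _ (fun A1 A2 => tens_mxDl A1 A2 B) (tens0mx B)).
by rewrite mulmx_sumr linear_sum.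
Qed.

Lemma inner_tens3 (u v w x y z : 'cV[C]_2) :
  ((u *t v *t w) ^t* *m tens_vec (tens_vec x y) z) 0 0 =
  (u ^t* *m x) 0 0 * (v ^t* *m y) 0 0 * (w ^t* *m z) 0 0.
Proof.
rewrite /tens_vec !adjoint_tens.
transitivity (((u ^t* *m x) *t (v ^t* *m y) *t (w ^t* *m z)) 0 0).
  by rewrite -tensmx_mul -tensmx_mul.
by rewrite !mxE !ord1.
Qed.

Lemma sum_tens_index m n (F : 'I_(m * n) -> C) :
  \sum_i F i = \sum_i \sum_j F (mxtens_index (i, j)).
Proof.
rewrite pair_big /=; apply: reindex; exists (@mxtens_unindex m n) => k _.
  by rewrite -surjective_pairing mxtens_indexK.
by rewrite -surjective_pairing mxtens_unindexK.
Qed.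

End ComplexMatrices.

(** * The partial trace as the adjoint of tensoring with the identity *)

Section Reduced.
Local Open Scope complex_scope.
Local Open Scope sesquilinear_scope.
Variables (R : realType) (d : party -> nat).
Variable psi : 'cV[R[i]]_(d Bob * d Alice).

Lemma trace_reduced_bob (A : 'M[R[i]]_(d Bob)) :
  \tr (reduced psi Bob *m A) =
  \tr (density psi *m (A *t (1%:M : 'M[R[i]]_(d Alice)))).
Proof.
rewrite /mxtrace sum_tens_index; apply: eq_bigr => k _.
rewrite mxE; under eq_bigr do rewrite mxE mulr_suml.
rewrite exchange_big; apply: eq_bigr => l _.
rewrite mxE sum_tens_index; apply: eq_bigr => k' _.
rewrite (bigD1 l) //= tensmxE [1%:M _ _]mxE eqxx mulr1 big1 ?addr0//.
move=> l' /negPf l'l.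
by rewrite tensmxE [1%:M _ _]mxE l'l !mulr0.
Qed.

Lemma trace_reduced_alice (A : 'M[R[i]]_(d Alice)) :
  \tr (reduced psi Alice *m A) =
  \tr (density psi *m ((1%:M : 'M[R[i]]_(d Bob)) *t A)).
Proof.
rewrite /mxtrace sum_tens_index [RHS]exchange_big; apply: eq_bigr => l _.
rewrite mxE; under [LHS]eq_bigr do rewrite mxE mulr_suml.
rewrite exchange_big; apply: eq_bigr => k _.
rewrite mxE sum_tens_index [RHS]exchange_big; apply: eq_bigr => l' _.
rewrite (bigD1 k) //= tensmxE [1%:M _ _]mxE eqxx mul1r big1 ?addr0//.
move=> k' /negPf k'k.
by rewrite tensmxE [1%:M _ _]mxE k'k mul0r mulr0.
Qed.

End Reduced.

(** * Amplitudes and joint projectors of the experiment *)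

Section Projectors.
Local Open Scope complex_scope.
Local Open Scope sesquilinear_scope.
Variables (R : realType) (h0 h1 phi : R).
Hypothesis h01 : h0 ^+ 2 + h1 ^+ 2 = 1.
Local Notation C := R[i].
Local Notation eigen := (eigenvector h0 h1 phi).
Local Notation proj := (qubit_proj h0 h1 phi).

Lemma expiD (x y : R) : expi (x + y) = expi x * expi y.
Proof.
apply/eqP; rewrite eq_complex /= cosD sinD eqxx addrC.
by rewrite eqxx.
Qed.

Lemma expi_conj (x : R) : Num.conj (expi x) * expi x = 1.
Proof.
apply/eqP; rewrite eq_complex /= !mulNr opprK -!expr2 cos2Dsin2 eqxx /=.
by rewrite [sin x * _]mulrC subrr.
Qed.

(** Each of the three eigenvectors carries one such factor; together they match the phase of the
    state. *)
Lemma expi_third : expi phi = expi (phi / 3) ^+ 3.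
Proof. by rewrite !exprS expr0 mulr1 -!expiD; congr expi; field. Qed.

Definition coef1 s o : C := recoef1 h0 h1 s o +i* imcoef1 _ s o.

Lemma eigenvectorE e s o :
  eigen e s o =
  (coef0 h0 h1 s o)%:C *: e 0 + (coef1 s o * expi (phi / 3)) *: e 1.
Proof.
case: s o => -[]; rewrite /coef1 /= ?complexr0.
- by [].
- by rewrite rmorphN mulNr scaleNr.
- rewrite scalerDr scalerA mulrA; congr (_ + (_ * _) *: _).
  by apply/eqP; rewrite eq_complex /= !mulr0 mul0r mulr1 subr0 addr0 !eqxx.
- rewrite scalerBr scalerA mulrA -scaleNr -mulNr; congr (_ + (_ * _) *: _).
  by apply/eqP; rewrite eq_complex /= !mulr0 mul0r mulr1 subr0 addr0 oppr0
    !eqxx.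
Qed.

Section Qubit.
Variable e : 'I_2 -> 'cV[C]_2.
Hypothesis e_basis : orthonormal_basis e.

Lemma eigen_inner0 s o : (eigen e s o) ^t* *m e 0 = ((coef0 h0 h1 s o)%:C)%:M.
Proof.
rewrite eigenvectorE inner_comb !e_basis /= !scale_scalar_mx mulr0 mulr1.
by rewrite raddf0 addr0 conjCE oppr0.
Qed.

Lemma eigen_inner1 s o :
  (eigen e s o) ^t* *m e 1 = (Num.conj (coef1 s o * expi (phi / 3)))%:M.
Proof.
rewrite eigenvectorE inner_comb !e_basis /= !scale_scalar_mx mulr0 mulr1.
by rewrite raddf0 add0r.
Qed.

Lemma sum_basis_proj : e 0 *m (e 0) ^t* + e 1 *m (e 1) ^t* = 1%:M.
Proof.
pose E : 'M[C]_2 := \matrix_(i, k) e k i 0.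
have EE : E ^t* *m E = 1%:M.
  apply/matrixP=> k l; have /matrixP/(_ 0 0) := e_basis k l.
  by rewrite !mxE mulr1n => <-; apply: eq_bigr => i _; rewrite !mxE.
(* For square matrices, orthonormal columns ([EE]) also give the product in the other order, which
   is the sum of the basis projectors. *)
rewrite -(mulmx1C EE); apply/matrixP=> i j.
rewrite !mxE !big_ord1 big_ord_recl big_ord1 !mxE.
by congr (_ + e _ _ _ * Num.conj (e _ _ _)); apply: val_inj.
Qed.

Lemma sum_proj : \sum_o proj e X o = 1%:M.
Proof.
rewrite sum_bool /qubit_proj !eigenvectorE -sum_basis_proj !rank1_comb.
have conj_real (x : R) : Num.conj (x%:C) = x%:C by rewrite conjCE oppr0.
have h01C : h0%:C * h0%:C + h1%:C * h1%:C = 1 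
  by rewrite -!rmorphM -rmorphD -!expr2 h01.
rewrite /coef1 /= complexr0 (complexr0 (- h1)) rmorphN !rmorphM rmorphN /=.
rewrite !conj_real.
have ww := expi_conj (phi / 3); set w := expi _ in ww *.
have comb (a b c d a' b' c' d' : C) (E00 E01 E10 E11 : 'M[C]_2) :
    a *: E00 + b *: E01 + (c *: E10 + d *: E11) +
    (a' *: E00 + b' *: E01 + (c' *: E10 + d' *: E11)) =
    (a + a') *: E00 + (b + b') *: E01 +
    ((c + c') *: E10 + (d + d') *: E11).
  by rewrite !scalerDl [LHS](AC ((2*2)*(2*2)) ((1*5*(2*6))*((3*7)*(4*8)))).
rewrite comb [X in X *: (e 0 *m e 0 ^t*) + _](_ : _ = 1); last first.
  by rewrite addrC h01C.
rewrite [X in X *: (e 0 *m e 1 ^t*)](_ : _ = 0); last by ring.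
rewrite [X in X *: (e 1 *m e 0 ^t*)](_ : _ = 0); last by ring.
rewrite [X in X *: (e 1 *m e 1 ^t*)](_ : _ = 1); last first.
  by transitivity ((h0%:C * h0%:C + h1%:C * h1%:C) * (Num.conj w * w));
    [ring | rewrite h01C ww mulr1].
by rewrite !scale0r !scale1r addr0 add0r.
Qed.

End Qubit.

Variables polB pathB polA : 'I_2 -> 'cV[C]_2.
Hypotheses (polB_basis : orthonormal_basis polB)
  (pathB_basis : orthonormal_basis pathB) (polA_basis : orthonormal_basis polA).

Local Notation state := (psi h0 h1 phi polB pathB polA).

Lemma amplitude s a s' b t c :
  ((eigen polB s a *t eigen pathB s' b *t eigen polA t c) ^t* *m state) 0 0 =
  (h0 * (coef0 h0 h1 s a * coef0 h0 h1 s' b * coef0 h0 h1 t c))%:C +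
  h1%:C * Num.conj (coef1 s a * coef1 s' b * coef1 t c).
Proof.
set W := (_ *t _) ^t*.
transitivity (h0%:C *
    (W *m tens_vec (tens_vec (polB 0) (pathB 0)) (polA 0)) 0 0 +
  (h1%:C * expi phi) *
    (W *m tens_vec (tens_vec (polB 1) (pathB 1)) (polA 1)) 0 0).
  by rewrite mulmxDr -!scalemxAr !mxE.
rewrite /W !inner_tens3.
rewrite !eigen_inner0// !eigen_inner1// !mxE !mulr1n !rmorphM /=.
congr (_ + _); rewrite expi_third; have ww := expi_conj (phi / 3).
(* Inserting the cube of [Num.conj w * w], which is one, on the right makes both sides equal as
   polynomials in [w] and its conjugate. *)
set w := expi _ in ww *; rewrite -[RHS]mulr1 -[X in _ = _ * X](expr1n _ 3) -ww.
ring.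
Qed.

Lemma trace_proj3 s a s' b t c :
  \tr (density (d := hdim) state *m
        (proj polB s a *t proj pathB s' b *t proj polA t c)) =
  (prob3 h0 h1 s a s' b t c)%:C.
Proof.
have -> : proj polB s a *t proj pathB s' b *t proj polA t c =
  (eigen polB s a *t eigen pathB s' b *t eigen polA t c) *m
  (eigen polB s a *t eigen pathB s' b *t eigen polA t c) ^t*.
  by rewrite !adjoint_tens !tensmx_mul.
rewrite trace_rank1 amplitude /coef1 /prob3; apply/eqP.
by rewrite eq_complex /=; apply/andP; split; apply/eqP; ring.
Qed.

Local Notation P := (meas_proj h0 h1 phi polB pathB polA).

Lemma joint_proj_alice (t : meas Alice) (c : {set meas Alice})
    (m : outcome bool c) : c = [set t] ->
  joint_proj P m = proj polA t (at_ m t).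
Proof.
move=> ec; have tc : t \in c by rewrite ec set11.
pose j0 : {j | j \in c} := exist _ t tc.
rewrite /joint_proj (@big_only1 _ _ _ _ j0)//=.
  by rewrite -(outcome_at_val false).
move=> [j jc] + _; rewrite -val_eqE /=.
by move=> /negP[]; apply/eqP/set1P; rewrite -ec.
Qed.

Lemma joint_proj_bob s s' (c : {set meas Bob}) (m : outcome bool c) :
  c = bob_context s s' ->
  joint_proj P m =
  proj polB s (at_ m (inl s)) *t proj pathB s' (at_ m (inr s')).
Proof.
move=> ec.
have cl : inl s \in c by rewrite ec !inE eqxx.
have cr : inr s' \in c by rewrite ec !inE eqxx orbT.
(* Every factor is a tensor product with an identity on one side, so the product splits into a
   polarization part and a path part, each with a single nontrivial factor. *)
pose pol (j : {j | j \in c}) : 'M[C]_2 :=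
  if val j is inl s0 then proj polB s0 (m j) else 1%:M.
pose path (j : {j | j \in c}) : 'M[C]_2 :=
  if val j is inr s0 then proj pathB s0 (m j) else 1%:M.
transitivity ((\big[mulmx/1%:M]_j pol j) *t (\big[mulmx/1%:M]_j path j)).
  apply: (big_ind3 (fun (D : 'M[C]_(2 * 2)) A B => D = A *t B)).
  - by rewrite tens_1mx.
  - by move=> D1 A1 B1 D2 A2 B2 -> ->; rewrite tensmx_mul.
  - by move=> [[j|j] jc] _.
pose jl : {j | j \in c} := exist _ (inl s) cl.
pose jr : {j | j \in c} := exist _ (inr s') cr.
rewrite (@big_only1 _ _ _ _ jl) ?(@big_only1 _ _ _ _ jr)//=.
- rewrite /pol /path /= -(outcome_at_val false m jl).
  by rewrite -(outcome_at_val false m jr).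
- move=> [j jc] + _; rewrite -val_eqE /= /path /=.
  have [ej|ej] : j = inl s \/ j = inr s' by apply: in_bob_context; rewrite -ec.
    by subst j.
  by subst j; rewrite eqxx.
- move=> [j jc] + _; rewrite -val_eqE /= /pol /=.
  have [ej|ej] : j = inl s \/ j = inr s' by apply: in_bob_context; rewrite -ec.
    by subst j; rewrite eqxx.
  by subst j.
Qed.

End Projectors.

(** * Born probabilities equal the real polynomials *)

Section BornProbabilities.
Local Open Scope complex_scope.
Variables (R : realType) (h0 h1 phi : R).
Hypothesis h01 : h0 ^+ 2 + h1 ^+ 2 = 1.
Variables polB pathB polA : 'I_2 -> 'cV[R[i]]_2.
Hypotheses (polB_basis : orthonormal_basis polB)
  (pathB_basis : orthonormal_basis pathB) (polA_basis : orthonormal_basis polA).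
Local Notation proj := (qubit_proj h0 h1 phi).

Lemma p_jointE (C : context meas) (m : joint_outcome bool C) s s' t :
  C Bob = bob_context s s' -> C Alice = [set t] ->
  p_joint h0 h1 phi polB pathB polA m =
  prob3 h0 h1 s (at_ (m Bob) (inl s)) s' (at_ (m Bob) (inr s'))
    t (at_ (m Alice) t).
Proof.
move=> eB eA; rewrite /p_joint /born.
rewrite (joint_proj_bob h0 h1 phi polB pathB polA (m Bob) eB).
rewrite (joint_proj_alice h0 h1 phi polB pathB polA (m Alice) eA).
by rewrite (trace_proj3 h0 h1 phi polB_basis pathB_basis polA_basis).
Qed.

Lemma p_local_bobE s s' (c : {set meas Bob}) (m : outcome bool c) :
  c = bob_context s s' ->
  p_local h0 h1 phi polB pathB polA m =
  prob2 h0 h1 s (at_ m (inl s)) s' (at_ m (inr s')).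
Proof.
move=> ec; rewrite /p_local /born_local trace_reduced_bob.
rewrite (joint_proj_bob h0 h1 phi polB pathB polA m ec).
rewrite (trace_tens_sumr _ _ (sum_proj phi h01 polA_basis)).
have tr3 := trace_proj3 h0 h1 phi polB_basis pathB_basis polA_basis.
under eq_bigr do rewrite tr3.
by rewrite -rmorph_sum /= (sum_prob3_alice h01).
Qed.

Lemma p_local_aliceE (t : meas Alice) (c : {set meas Alice})
    (m : outcome bool c) : c = [set t] ->
  p_local h0 h1 phi polB pathB polA m = prob1 h0 h1 t (at_ m t).
Proof.
move=> ec; rewrite /p_local /born_local trace_reduced_alice.
rewrite (joint_proj_alice h0 h1 phi polB pathB polA m ec).
(* Bob is traced out through the complete joint measurement of [X] on both his qubits. *)
have sum1 : \sum_(ab : bool * bool)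
    proj polB X ab.1 *t proj pathB X ab.2 = 1%:M.
  rewrite -(pair_bigA _ (fun a b => proj polB X a *t proj pathB X b)) /=.
  rewrite -tens_1mx -{1}(sum_proj phi h01 polB_basis).
  rewrite -(sum_proj phi h01 pathB_basis) !sum_bool.
  by rewrite !(tens_mxDl, tens_mxDr).
rewrite (trace_tens_suml _ _ sum1).
have tr3 := trace_proj3 h0 h1 phi polB_basis pathB_basis polA_basis.
under eq_bigr do rewrite tr3.
rewrite -rmorph_sum /= -(sum_prob3_bob h01 X X).
exact/esym/pair_bigA.
Qed.

End BornProbabilities.

(** * Local noncontextuality *)

(** Born probability of [o] in the basis vector of index [l], where [l] labels the two terms of the
    state. *)
Definition schmidt_weight (R : realType) (h0 h1 : R) (l : bool) s o : R :=
  if l then weight1 h0 h1 s o else weight0 h0 h1 s o.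

Lemma schmidt_weight_pmf (R : realType) (h0 h1 : R) l s :
  h0 ^+ 2 + h1 ^+ 2 = 1 -> is_pmf (schmidt_weight h0 h1 l s).
Proof.
move=> h01; apply: is_pmf_finType => [x|]; case: l.
- exact: weight1_ge0.
- exact: weight0_ge0.
- exact: sum_weight1.
- exact: sum_weight0.
Qed.

Lemma NCHV_local_p_local (R : realType) (h0 h1 phi : R)
    (polB pathB polA : 'I_2 -> 'cV[complex R]_2) :
  h0 ^+ 2 + h1 ^+ 2 = 1 -> orthonormal_basis polB -> orthonormal_basis pathB ->
  orthonormal_basis polA ->
  NCHV_local local_contexts (p_local h0 h1 phi polB pathB polA).
Proof.
move=> h01 polB_basis pathB_basis polA_basis i.
pose q (l : bool) := if l then h1 ^+ 2 else h0 ^+ 2.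
have q_pmf : is_pmf q.
  apply: is_pmf_finType => [l|]; first by case: l; exact: sqr_ge0.
  by rewrite sum_bool addrC.
have wt_ge0 l s o : 0 <= schmidt_weight h0 h1 l s o.
  by have [] := schmidt_weight_pmf l s h01.
case: i.
- exists bool, q, (fun (j : meas Bob) l =>
    schmidt_weight h0 h1 l (match j with inl s => s | inr s => s end)).
  split=> // [j l|c c_loc m]; first exact: schmidt_weight_pmf.
  have [s [s' ec]] := local_contexts_bob c_loc.
  rewrite esum_finType => [|l]; last first.
    by rewrite mulr_ge0 ?prodr_ge0//; have [] := q_pmf.
  rewrite (p_local_bobE phi h01 polB_basis pathB_basis polA_basis m ec).
  congr _%:E; rewrite sum_bool [RHS]addrC; congr (_ * _ + _ * _); apply: esym;
    exact: (prod_outcome_bob m (fun j => schmidt_weight h0 h1 _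
      (match j with inl s => s | inr s => s end)) ec).
- exists bool, q, (fun (j : meas Alice) l => schmidt_weight h0 h1 l j).
  split=> // [j l|c c_loc m]; first exact: schmidt_weight_pmf.
  have [s ec] := local_contexts_alice c_loc.
  rewrite esum_finType => [|l]; last first.
    by rewrite mulr_ge0 ?prodr_ge0//; have [] := q_pmf.
  rewrite (p_local_aliceE phi h01 polB_basis pathB_basis polA_basis m ec).
  congr _%:E; rewrite sum_bool [RHS]addrC; congr (_ * _ + _ * _); apply: esym;
    exact: (prod_outcome_alice m (fun j => schmidt_weight h0 h1 _ j) ec).
Qed.

(** * The GLHV model *)

Section GLHVModel.
Variables (R : realType) (h0 h1 phi : R).
Hypothesis h01 : h0 ^+ 2 + h1 ^+ 2 = 1.

(** Responses take a set as context, so the settings must be recovered from it; the value on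
    untested sets is arbitrary. *)
Definition pol_setting (c : {set meas Bob}) := if inl X \in c then X else Y.

Definition path_setting (c : {set meas Bob}) := if inr X \in c then X else Y.

Lemma bob_contextK s s' :
  pol_setting (bob_context s s') = s /\ path_setting (bob_context s s') = s'.
Proof. by rewrite /pol_setting /path_setting !inE; case: s; case: s'. Qed.

(** Marginal of [coupling] on Alice's two outcomes: [x] has its quantum distribution and [y] is an
    independent fair bit. *)
Definition glhv_prior (xy : bool * bool) : R := prob1 h0 h1 X xy.1 / 2.

Definition glhv_alice (xy : bool * bool) (s : setting) : bool :=
  if s is X then xy.1 else xy.2.

Definition glhv_bob_weight (c : {set meas Bob}) (xy : bool * bool)
    (m : outcome bool c) : R :=
  let s := pol_setting c in let s' := path_setting c in
  coupling h0 h1 s s' xy.1 xy.2 (at_ m (inl s)) (at_ m (inr s')).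

(** The hidden value is Alice's pair of answers, which she returns deterministically; Bob samples
    from [coupling] conditioned on that pair. *)
Definition glhv_resp (i : party) :
    forall (c : {set meas i}), bool * bool -> outcome bool c -> R :=
  match i with
  | Bob => fun c xy => normalize [ffun=> false] (@glhv_bob_weight c xy)
  | Alice => fun c xy m => (m == [ffun j => glhv_alice xy (val j)])%:R
  end.

Lemma glhv_bob_weight_ge0 c xy m : 0 <= @glhv_bob_weight c xy m.
Proof. exact: coupling_ge0. Qed.

Lemma glhv_prior_pmf : is_pmf glhv_prior.
Proof.
apply: is_pmf_finType => [xy|]; first by rewrite divr_ge0 ?prob1_ge0.
rewrite -(pair_bigA _ (fun x y => glhv_prior (x, y))) /=.
rewrite -[RHS](sum_prob1 h01 X).
by apply: eq_bigr => x _; rewrite sum_bool /glhv_prior /=; field.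
Qed.

Lemma glhv_resp_pmf i c xy : is_pmf (@glhv_resp i c xy).
Proof.
case: i c => c /=; first exact/normalize_pmf/glhv_bob_weight_ge0.
apply: is_pmf_finType => [m|]; first exact: ler0n.
rewrite (bigD1 [ffun j => glhv_alice xy (val j)])//= eqxx big1 ?addr0//.
by move=> m /negPf->.
Qed.

(** The normalizing total is the prior in every Bob context, so prior times response gives back
    [coupling] while a single prior serves all contexts. *)
Lemma sum_glhv_bob_weight s s' c xy : c = bob_context s s' ->
  \sum_m @glhv_bob_weight c xy m = glhv_prior xy.
Proof.
move=> ec; have [] := bob_contextK s s'; rewrite -ec => es es'.
rewrite /glhv_bob_weight /glhv_prior es es' -(sum_coupling_bob h01 s s' _ xy.2).
exact: (sum_outcome_bob (fun a b => coupling h0 h1 s s' xy.1 xy.2 a b) ec).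
Qed.

Lemma glhv_alice_resp t c xy (m : outcome bool c) : c = [set t] ->
  glhv_resp (i := Alice) xy m = (at_ m t == glhv_alice xy t)%:R.
Proof.
move=> ec /=; congr (_%:R); congr nat_of_bool.
have tc : t \in c by rewrite ec set11.
apply/eqP/eqP => [->|mt].
  exact: (outcome_at_finfun (i := Alice) false (glhv_alice xy) tc).
apply/ffunP=> j; rewrite ffunE -(outcome_at_val false m j).
have jt : val j = t by apply/set1P; rewrite -ec; exact: valP.
by rewrite jt mt -jt.
Qed.

Lemma GLHV_p_joint (polB pathB polA : 'I_2 -> 'cV[complex R]_2) :
  orthonormal_basis polB -> orthonormal_basis pathB ->
  orthonormal_basis polA ->
  GLHV tested_contexts (p_joint h0 h1 phi polB pathB polA).
Proof.
move=> polB_basis pathB_basis polA_basis.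
exists (bool * bool)%type, glhv_prior, glhv_resp.
split=> [||C tC m]; [exact: glhv_prior_pmf|exact: glhv_resp_pmf|].
have [s [s' eB]] := local_contexts_bob (tC Bob).
have [t eA] := local_contexts_alice (tC Alice).
rewrite esum_finType => [|xy]; last first.
  rewrite mulr_ge0 ?prodr_ge0//; first by have [] := glhv_prior_pmf.
  by move=> i _; have [] := glhv_resp_pmf (C i) xy.
rewrite (p_jointE h0 h1 phi polB_basis pathB_basis polA_basis m eB eA).
congr _%:E.
set a := at_ (m Bob) (inl s); set b := at_ (m Bob) (inr s').
transitivity (\sum_xy coupling h0 h1 s s' xy.1 xy.2 a b *
                       (at_ (m Alice) t == glhv_alice xy t)%:R); last first.
  apply: eq_bigr => xy _; rewrite prod_party mulrA (glhv_alice_resp _ _ eA).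
  congr (_ * _); rewrite -(sum_glhv_bob_weight xy eB) sum_mul_normalize.
    have [] := bob_contextK s s'; rewrite -eB => es es'.
    by rewrite /glhv_bob_weight es es'.
  exact: glhv_bob_weight_ge0.
rewrite -(pair_bigA _ (fun x y => coupling h0 h1 s s' x y a b *
                       (at_ (m Alice) t == glhv_alice (x, y) t)%:R)) /=.
(* Alice's indicator fixes [x] if she measures [X] and [y] if she measures [Y]; summing out the
   other bit leaves a marginal of [coupling]. *)
move: (at_ (m Alice) t) => c; case: t {eA} => /=.
  rewrite (bigD1 c)//= [X in _ + X]big1 ?addr0 => [|x /negPf xc].
    by under eq_bigr do rewrite eqxx mulr1; rewrite sum_coupling_Y.
  by rewrite big1// => y _; rewrite eq_sym xc mulr0.
rewrite exchange_big (bigD1 c)//= [X in _ + X]big1 ?addr0 => [|y /negPf yc].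
  by under eq_bigr do rewrite eqxx mulr1; rewrite sum_coupling_X.
by rewrite big1// => x _; rewrite eq_sym yc mulr0.
Qed.

End GLHVModel.

(** * Impossibility of a GNCHV model *)

Lemma not_GNCHV_p_joint (R : realType) (h0 h1 phi : R)
    (polB pathB polA : 'I_2 -> 'cV[complex R]_2) :
  h0 ^+ 2 + h1 ^+ 2 = 1 -> h0 != 0 -> h1 != 0 -> orthonormal_basis polB ->
  orthonormal_basis pathB -> orthonormal_basis polA ->
  ~ GNCHV tested_contexts (p_joint h0 h1 phi polB pathB polA).
Proof.
move=> h01 h0N h1N polB_basis pathB_basis polA_basis.
move=> [L [q [resp [q_pmf resp_pmf model]]]].
have resp_ge0 i j l o : 0 <= resp i j l o by have [] := resp_pmf i j l.
pose r1 s l a := resp Bob (inl s) l a.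
pose r1' s l b := resp Bob (inr s) l b.
pose r2 (s : setting) l c := resp Alice s l c.
pose term s a s' b t c l := q l * (r1 s l a * r1' s' l b * r2 t l c).
have term_ge0 s a s' b t c l : 0 <= term s a s' b t c l.
  by have [q_ge0 _] := q_pmf; rewrite mulr_ge0// mulr_ge0 ?mulr_ge0 ?resp_ge0.
have prob3_term s a s' b t c : (prob3 h0 h1 s a s' b t c)%:E =
    \esum_(l in [set: L]%classic) (term s a s' b t c l)%:E.
  pose C : context meas := fun i => match i return {set meas i} with
    | Bob => bob_context s s' | Alice => [set t] end.
  have tC : tested_contexts C.
    by case; [exact: bob_context_local|exact: alice_context_local].
  pose o (i : party) (j : meas i) : bool := match i return meas i -> bool with
    | Bob => fun j => if j is inl _ then a else b | Alice => fun=> c end j.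
  pose m : joint_outcome bool C := fun i => [ffun j => o i (val j)].
  have at_m i j : j \in C i -> at_ (m i) j = o i j.
    by move=> jC; rewrite /m (outcome_at_finfun false (o i) jC).
  have at1 : at_ (m Bob) (inl s) = a by apply: at_m; rewrite !inE eqxx.
  have at2 : at_ (m Bob) (inr s') = b by apply: at_m; rewrite !inE eqxx orbT.
  have at3 : at_ (m Alice) t = c by apply: (at_m Alice t); rewrite set11.
  have := p_jointE h0 h1 phi polB_basis pathB_basis polA_basis (C := C) m
    erefl erefl.
  rewrite at1 at2 at3 => <-; rewrite model//; apply: eq_esum => l _.
  rewrite prod_party (prod_outcome_bob (m Bob)
    (fun j o => resp Bob j l o) erefl).
  rewrite (prod_outcome_alice (m Alice) (fun j o => resp Alice j l o) erefl).
  by rewrite at1 at2 at3.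
have term_eq0 s a s' b t c l : prob3 h0 h1 s a s' b t c = 0 ->
    term s a s' b t c l = 0.
  move=> p0; apply: (esum_eq0P (term_ge0 s a s' b t c)).1.
  by rewrite -prob3_term p0.
(* Some hidden value contributes to the event that all three [X] outcomes are one; there the prior
   and the three responses are nonzero. *)
have [l termN] : exists l, term X true X true X true l != 0.
  apply/not_existsP => term0; have := prob3_XXX_neq0 h01 h0N h1N.
  rewrite -eqe prob3_term (esum_eq0P (term_ge0 _ _ _ _ _ _)).2 ?eqxx// => l.
  by apply/eqP/negP=> /negP/term0.
move: termN; rewrite !mulf_eq0 !negb_or => /andP[ql /andP[/andP[x1 x1'] x2]].
(* At this [l] each [Y] measurement has a possible outcome. Were two of these equal, the third
   system giving [X = 1] would yield a nonzero term of a zero probability. *)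
have [y1 y1N] := pmf_supp (resp_pmf Bob (inl Y) l).
have [y1' y1'N] := pmf_supp (resp_pmf Bob (inr Y) l).
have [y2 y2N] := pmf_supp (resp_pmf Alice Y l).
have y1y1' : y1 != y1'.
  apply/negP=> /eqP e; subst y1'.
  have /eqP := term_eq0 _ _ _ _ _ _ l (prob3_YYX_eq0 h0 h1 y1).
  by apply/negP; rewrite /term !mulf_neq0.
have y1y2 : y1 != y2.
  apply/negP=> /eqP e; subst y2.
  have /eqP := term_eq0 _ _ _ _ _ _ l (prob3_YXY_eq0 h0 h1 y1).
  by apply/negP; rewrite /term !mulf_neq0.
have y1'y2 : y1' != y2.
  apply/negP=> /eqP e; subst y2.
  have /eqP := term_eq0 _ _ _ _ _ _ l (prob3_XYY_eq0 h0 h1 y1').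
  by apply/negP; rewrite /term !mulf_neq0.
by case: y1 y1' y2 {y1N y1'N y2N} y1y1' y1y2 y1'y2 => [] [] [].
Qed.

Theorem mainTheorem1 (R : realType) (h0 h1 phi : R)
    (polB pathB polA : 'I_2 -> 'cV[complex R]_2)
    (h0_ge0 : 0 <= h0) (h1_ge0 : 0 <= h1) (h01 : h0 ^+ 2 + h1 ^+ 2 = 1)
    (polB_basis : orthonormal_basis polB)
    (pathB_basis : orthonormal_basis pathB)
    (polA_basis : orthonormal_basis polA) :
  let pl := p_local h0 h1 phi polB pathB polA in
  let p := p_joint h0 h1 phi polB pathB polA in
  [/\ NCHV_local local_contexts pl,
      (0 <= h0 <= 1 -> GLHV tested_contexts p),
      (0 < h0 < 1 -> ~ GNCHV tested_contexts p) &
      (0 < h0 < 1 -> globally_contextual local_contexts tested_contexts pl p)].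
Proof.
move=> pl p; have nchv : NCHV_local local_contexts pl.
  exact: NCHV_local_p_local.
have glhv : GLHV tested_contexts p by exact: GLHV_p_joint.
have no_gnchv : 0 < h0 < 1 -> ~ GNCHV tested_contexts p.
  move=> /andP[h0_gt0 h0_lt1]; apply: not_GNCHV_p_joint => //.
    by rewrite gt_eqF.
  (* If [h1] were zero, [h0 ^+ 2] would be one, hence [h0] would be one by nonnegativity. *)
  apply: contra_ltN h0_lt1 => /eqP h1_eq0; move: h01.
  by rewrite h1_eq0 expr0n addr0 => /eqP; rewrite sqrp_eq1// => /eqP->.
by split=> // h0_in; split=> //; exact: no_gnchv.
Qed.
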